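(* For every positive integer $n$, $$\overline{\mathrm{spt}}(7n)\equiv \overline{\mathrm{spt}}(n/7)\pmod 4\quad\text{and}\quad \overline{\mathrm{spt}}_{\omega}(7n)\equiv \overline{\mathrm{spt}}_{\omega}(n/7)\pmod 4,$$ with the convention that $\overline{\mathrm{spt}}(x)=\overline{\mathrm{spt}}_{\omega}(x)=0$ if $x$ is not a positive integer.
   Context: $(a;q)_n=\prod_{j=0}^{n-1}(1-aq^j)$, $(a;q)_\infty=\prod_{j\ge0}(1-aq^j)$. $\overline{\mathrm{spt}}(n)$ is defined by $\sum_{n\ge1}\overline{\mathrm{spt}}(n)q^n=\sum_{n\ge1}\frac{q^n(-q^{n+1};q)_\infty}{(1-q^n)^2(q^{n+1};q)_\infty}$. $\overline{\mathrm{spt}}_{\omega}(n)$ is defined by $\sum_{n\ge1}\overline{\mathrm{spt}}_{\omega}(n)q^n=\sum_{n\ge1}\frac{q^{n}(-q^{n+1};q)_{n}(-q^{2n+2};q^2)_{\infty}}{(1-q^n)^2(q^{n+1};q)_n(q^{2n+2};q^2)_{\infty}}$. *)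

(* Defs.v *)
From mathcomp Require Import all_boot.
Set Implicit Arguments. Unset Strict Implicit. Unset Printing Implicit Defensive.

(* a formal power series in q: n |-> coefficient of q^n *)
Definition fps := nat -> nat.

Definition fmul (f g : fps) : fps := fun n => \sum_(i < n.+1) f i * g (n - i).
Definition fone : fps := fun n => (n == 0%N : nat).

Definition qpow (m : nat) : fps := fun n => (n == m : nat).
Definition onepq (j : nat) : fps := fun n => ((n == 0%N) : nat) + ((n == j) : nat).
(* 1/(1 - q^j) = sum_k q^(j k), for j >= 1 *)
Definition geomq (j : nat) : fps := fun n => ((j %| n) : nat).

Definition fprod (a b : nat) (F : nat -> fps) : fps :=
  \big[fmul/fone]_(a <= j < b) F j.

(* infinite product prod_(k >= 0) F k, where F k = 1 + O(q^(k+1)):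
   the coefficient of q^N only depends on the factors with k < N, so it is
   the coefficient of q^N in the finite product over k < N.
   (This is the usual q-adic limit of the partial products.) *)
Definition fprod_inf (F : nat -> fps) : fps := fun N => fprod 0 N F N.

Definition invsq (m : nat) : fps := fmul (geomq m) (geomq m).

(* summand of the spt-bar generating function, for m >= 1:
   q^m (-q^{m+1};q)_oo / ((1-q^m)^2 (q^{m+1};q)_oo)
   = q^m/(1-q^m)^2 * prod_{k>=0} (1+q^{m+1+k})/(1-q^{m+1+k}) *)
Definition spt_term (m : nat) : fps :=
  fmul (qpow m) (fmul (invsq m)
    (fprod_inf (fun k => fmul (onepq (m + 1 + k)) (geomq (m + 1 + k))))).

(* summand of the spt-bar_omega generating function, for m >= 1:
   q^m (-q^{m+1};q)_m (-q^{2m+2};q^2)_oo / ((1-q^m)^2 (q^{m+1};q)_m (q^{2m+2};q^2)_oo) *)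
Definition sptw_term (m : nat) : fps :=
  fmul (qpow m) (fmul (invsq m)
    (fmul (fprod (m + 1) (2 * m + 1) (fun j => fmul (onepq j) (geomq j)))
          (fprod_inf (fun k => fmul (onepq (2 * m + 2 + 2 * k))
                                    (geomq (2 * m + 2 + 2 * k)))))).

(* sum_{m >= 1} T m, where T m = O(q^m): the coefficient of q^N only
   involves the terms with m <= N. *)
Definition fsum_from1 (T : nat -> fps) : fps := fun N => \sum_(1 <= m < N.+1) T m N.

Definition sptbar (n : nat) : nat := fsum_from1 spt_term n.
Definition sptbar_omega (n : nat) : nat := fsum_from1 sptw_term n.

Definition at_div7 (f : nat -> nat) (n : nat) : nat :=
  if (7 %| n) && (0 < n %/ 7) then f (n %/ 7) else 0.

(* Main.v *)
Require Import Defs.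
From mathcomp Require Import all_boot.
From mathcomp Require Import zify.

(* Modulo 4, (1+q^j)/(1-q^j) = 1 + 2 q^j/(1-q^j), so both products linearise and
   each function becomes sigma(n) + 2 A(n), where A(n) counts the positive
   solutions of m k + j l = n with k odd and a condition on (m, j): m < j for
   sptbar, and additionally (j <= 2 m or j even) for sptbar_omega.
   Since sigma(7n) + 7 sigma(n/7) = 8 sigma(n), only the parity of A matters.
   The shear (m, k, j, l) -> (m, k + l, j - m, l), followed if necessary by a
   swap, turns m < j, k odd into: s odd, l even in m s + d l = n.  Involutions
   cancel all solutions but those with m = 2^a s and l = 2 d, that is
   n = 2^a s^2 + 2 d^2.  Modulo 7, 2 is a square and -1 is not, so this form is
   divisible by 7 only if 7 | s and 7 | d: the remaining solutions for 7n are
   7 times those for n/7.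
   For sptbar_omega one subtracts the solutions with j > 2m and j, k odd; the
   involution (m, k, j, l) -> (l, j - 2m, k + 2l, m) reduces them to
   n = 2 m (m + k) with k odd, and then to n = 2^(a+1) o^2 with a > 0, o odd. *)

(** * Positive solutions of m k + j l = n as finite lists *)

Definition quad : Type := ((nat * nat) * (nat * nat))%type.

Definition qform (x : quad) : nat := x.1.1 * x.1.2 + x.2.1 * x.2.2.

Definition box (n : nat) : seq quad :=
  let r := [seq (a, b) | a <- iota 1 n, b <- iota 1 n] in
  [seq (x, y) | x <- r, y <- r].

Definition sols (R : pred quad) (n : nat) : seq quad :=
  [seq x <- box n | (qform x == n) && R x].

Definition qpos (x : quad) : bool :=
  [&& 0 < x.1.1, 0 < x.1.2, 0 < x.2.1 & 0 < x.2.2].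

Lemma mem_box n m k j l : (((m, k), (j, l)) \in box n) =
  [&& 0 < m <= n, 0 < k <= n, 0 < j <= n & 0 < l <= n].
Proof.
have mem_pair (T : eqType) (r : seq T) (a b : T) :
    ((a, b) \in [seq (x, y) | x <- r, y <- r]) = (a \in r) && (b \in r).
  apply/allpairsP/andP => [[[x y] /= [xr yr [-> ->]]]//|[ar br]].
  by exists (a, b).
by rewrite !mem_pair !mem_iota !add1n !ltnS -!andbA.
Qed.

Lemma sols_uniq R n : uniq (sols R n).
Proof.
have pair_uniq (T : eqType) (r : seq T) : uniq r -> uniq [seq (x, y) | x <- r, y <- r].
  by move=> ur; apply: allpairs_uniq => // -[? ?] [? ?].
by apply/filter_uniq/pair_uniq/pair_uniq/iota_uniq.
Qed.

(** Both products in m k + j l = n are positive, so no entry of a solution exceeds n and the finite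
    range [box n] loses nothing. *)
Lemma mem_sols R n (x : quad) :
  (x \in sols R n) = [&& qpos x, qform x == n & R x].
Proof.
case: x => [[m k] [j l]]; rewrite mem_filter mem_box /qpos /qform /=.
case: (R _); rewrite ?andbF ?andbT //.
case: eqP => [<-|_]; rewrite ?andbF ?andbT //=.
apply/idP/idP; nia.
Qed.

(** * Counting by bijections and involutions *)

Lemma leq_size_inj (S T : eqType) (s : seq S) (t : seq T) (f : S -> T) (g : T -> S) :
  uniq s -> {in s, forall x, f x \in t} -> {in s, cancel f g} -> size s <= size t.
Proof.
move=> us fst fK; rewrite -(size_map f) uniq_leq_size //.
  by rewrite map_inj_in_uniq // => x y xs ys e; rewrite -(fK x) // e fK.
by move=> _ /mapP[x xs ->]; apply: fst.
Qed.

Lemma size_bij (S T : eqType) (s : seq S) (t : seq T) (f : S -> T) (g : T -> S) :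
  uniq s -> uniq t ->
  {in s, forall x, f x \in t} -> {in t, forall y, g y \in s} ->
  {in s, cancel f g} -> {in t, cancel g f} -> size s = size t.
Proof.
move=> us ut fst gts fK gK; apply/eqP; rewrite eqn_leq.
by rewrite (leq_size_inj _ _ s t f g) // (leq_size_inj _ _ t s g f).
Qed.

(** Induction on the length: a fixed head is removed alone, any other head x together with [f x]. In
    both cases the remaining list is still stable under [f]. *)
Lemma odd_involution (T : eqType) (f : T -> T) (s : seq T) :
  uniq s -> {in s, forall x, f x \in s} -> {in s, involutive f} ->
  odd (size s) = odd (count (fun x => f x == x) s).
Proof.
have [n] := ubnP (size s); elim: n s => // n IHn [|x s] //= /ltnSE sn.
move=> /andP[xs us] fs fK.
have [fx|fx] := eqVneq (f x) x.
  rewrite add1n /= (IHn s) //.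
    move=> y ys; have := fs y; rewrite !inE ys orbT => /(_ isT) /predU1P[fy|//].
    by move: xs; rewrite -fx -fy fK ?inE ?ys ?orbT // ys.
  by move=> y ys; apply: fK; rewrite inE ys orbT.
have fxs : f x \in s.
  by have := fs x; rewrite !inE eqxx (negPf fx) => /(_ isT).
rewrite (perm_size (perm_to_rem fxs)) /= negbK.
rewrite (permP (perm_to_rem fxs)) /= fK ?inE ?eqxx // eq_sym (negPf fx) /=.
have in_s y : y \in rem (f x) s -> [/\ y \in x :: s, y != f x & y != x].
  rewrite mem_rem_uniq // !inE => /andP[yfx ys]; rewrite ys orbT yfx.
  by split=> //; apply: contraNneq xs => <-.
rewrite (IHn (rem (f x) s)) ?rem_uniq //.
- by rewrite (leq_trans _ sn) // size_rem //; case: (s) fxs.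
- move=> y /in_s[ys yfx yx]; have := fs _ ys.
  rewrite mem_rem_uniq // !inE => /predU1P[fy|->].
    by move: yfx; rewrite -fy fK ?eqxx.
  rewrite andbT; apply: contraNneq yx => e.
  by rewrite -(fK _ ys) e fK // inE eqxx.
- by move=> y /in_s[ys _ _]; apply: fK.
Qed.

Lemma odd_sols_involution (R : pred quad) (f : quad -> quad) n :
  {in sols R n, forall x, f x \in sols R n} -> {in sols R n, involutive f} ->
  odd (size (sols R n)) = odd (size (sols (fun x => R x && (f x == x)) n)).
Proof.
move=> fs fK; rewrite (odd_involution _ f) ?sols_uniq // -size_filter -filter_predI.
by congr (odd (size _)); apply: eq_filter => x /=; rewrite andbC andbA.
Qed.

Lemma size_sols_bij (R R' : pred quad) (f g : quad -> quad) n :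
  {in sols R n, forall x, f x \in sols R' n} ->
  {in sols R' n, forall x, g x \in sols R n} ->
  {in sols R n, cancel f g} -> {in sols R' n, cancel g f} ->
  size (sols R n) = size (sols R' n).
Proof. by apply: size_bij; apply: sols_uniq. Qed.

Lemma size_sols_split (R Q : pred quad) n :
  size (sols R n) = size (sols (fun x => R x && Q x) n)
                  + size (sols (fun x => R x && ~~ Q x) n).
Proof.
rewrite -[LHS](count_predC Q) -!size_filter /sols -!filter_predI.
by congr addn; congr size; apply: eq_filter => x /=; rewrite andbC andbA.
Qed.

(** * Scaling solutions by 7 *)

Definition scale7 (x : quad) : quad := ((7 * x.1.1, 7 * x.1.2), (7 * x.2.1, 7 * x.2.2)).
Definition unscale7 (x : quad) : quad :=
  ((x.1.1 %/ 7, x.1.2 %/ 7), (x.2.1 %/ 7, x.2.2 %/ 7)).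

(** Scaling all entries by 7 multiplies the form by 49. If every solution for 7 n is such a
    multiple, then 7 n = 49 n', so solutions exist only when 7 divides n, and they come from those
    for n' = n / 7. *)
Lemma size_sols_mul7 (R : pred quad) n :
  (forall x, qpos x -> R (scale7 x) = R x) ->
  (forall x, qpos x -> R x -> 7 %| qform x ->
     [&& 7 %| x.1.1, 7 %| x.1.2, 7 %| x.2.1 & 7 %| x.2.2]) ->
  size (sols R (7 * n)) = if 7 %| n then size (sols R (n %/ 7)) else 0.
Proof.
move=> R7 R7V.
have unscaleK (N : nat) (x : quad) : x \in sols R (7 * N) -> scale7 (unscale7 x) = x.
  rewrite mem_sols => /and3P[px /eqP ex Rx].
  have := R7V x px Rx; rewrite ex dvdn_mulr // => /(_ isT).
  case: x {px ex Rx} => [[m k] [j l]] /= /and4P[? ? ? ?].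
  by rewrite /scale7 /unscale7 /= ![7 * _]mulnC !divnK.
have form7 x : qform (scale7 x) = 49 * qform x.
  by rewrite /qform /scale7 /=; lia.
have pos7 x : qpos (scale7 x) = qpos x by rewrite /qpos /scale7 /= !muln_gt0.
case: ifP => [/dvdnP[n' ->]|n7].
  rewrite mulnK //; symmetry.
  apply: (size_bij _ _ _ _ scale7 unscale7); rewrite ?sols_uniq //.
  - move=> x; rewrite !mem_sols => /and3P[px /eqP ex Rx].
    by rewrite pos7 px R7 // Rx form7 ex andbT; apply/eqP; lia.
  - move=> x xs; have e := unscaleK _ x xs; move: xs.
    rewrite !mem_sols -{1 2 3}e pos7 form7 => /and3P[px /eqP ex].
    by rewrite R7 // px => ->; rewrite andbT; apply/eqP; lia.
  - by move=> [[? ?] [? ?]] _; rewrite /unscale7 /scale7 /= !mulKn.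
  - exact: unscaleK.
case E: (sols R (7 * n)) => [|x s] //.
have xs : x \in sols R (7 * n) by rewrite E mem_head.
have := unscaleK _ x xs; move: xs; rewrite mem_sols => /and3P[_ /eqP ex _] xE.
by move: n7; rewrite -(@dvdn_pmul2l 7) // -ex -xE form7 (@dvdn_mulr _ 49).
Qed.

Lemma mem_sols4 R n m k j l : (((m, k), (j, l)) \in sols R n) =
  [&& [&& 0 < m, 0 < k, 0 < j & 0 < l], m * k + j * l == n & R ((m, k), (j, l))].
Proof. exact: mem_sols. Qed.

(** * From m < j with k odd to n = 2^a s^2 + 2 d^2 *)

Lemma odd_partC2 m : odd m`_2^'.
Proof. by rewrite odd_2'nat part_pnat. Qed.

(** Together with [partC2M_odd], this makes exchanging the odd part of m with an odd s, while
    keeping the 2-part of m, an involution. *)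
Lemma part2M_odd a s : odd s -> 0 < a -> (a`_2 * s)`_2 = a`_2.
Proof.
move=> os a0; have s0 : 0 < s by case: s os.
have s2 : s`_2 = 1 by rewrite part_p'nat // -odd_2'nat.
by rewrite partnM ?part_gt0 // s2 muln1 part_pnat_id ?part_pnat.
Qed.

Lemma partC2M_odd a s : odd s -> 0 < a -> (a`_2 * s)`_2^' = s.
Proof.
move=> os a0; have s0 : 0 < s by case: s os.
apply/eqP; rewrite -(eqn_pmul2l (part_gt0 2 a)) -{1}(part2M_odd a s) //.
by rewrite partnC // muln_gt0 part_gt0.
Qed.

Definition rank_pairs : pred quad := fun '((m, k), (j, l)) => odd k && (m < j).

Definition mixed_parity : pred quad := fun '((m, s), (d, l)) => odd s && ~~ odd l.

(** With 2^a the 2-part of m, these are the representations n = 2^a s^2 + 2 d^2 with s odd. They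
    remain quadruples so that [size_sols_mul7] applies. *)
Definition square_pairs : pred quad :=
  fun '((m, s), (d, l)) => [&& odd s, l == 2 * d & m == m`_2 * s].

(** The shear preserves the form because m (k + l) + (j - m) l = m k + j l. As k is odd, exactly one
    of l and k + l is odd; the swap puts the pair containing it first. *)
Lemma size_rank_pairs n :
  size (sols rank_pairs n) = size (sols mixed_parity n).
Proof.
apply: (size_sols_bij _ _
  (fun '((m, k), (j, l)) => if odd l then ((j - m, l), (m, k + l))
                            else ((m, k + l), (j - m, l)))
  (* Since k + l > l, comparing s with l reveals whether the swap was made. *)
  (fun '((m, s), (d, l)) => if l < s then ((m, s - l), (m + d, l))
                            else ((d, l - s), (m + d, s)))).
- move=> [[m k] [j l]]; rewrite mem_sols4 /rank_pairs.
  case/and3P => /and4P[m0 k0 j0 l0] /eqP e /andP[ok mj].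
  by case: ifPn => ol; rewrite mem_sols4 /mixed_parity oddD ok ?ol ?(negPf ol) /= ?andbT; nia.
- move=> [[m s] [d l]]; rewrite mem_sols4 /mixed_parity.
  case/and3P => /and4P[m0 k0 j0 l0] /eqP e /andP[os ol].
  have ? : l <> s by move=> ls; rewrite ls os in ol.
  by case: ltnP => ls; rewrite mem_sols4 /rank_pairs oddB ?os ?(negPf ol) /= ?andbT //; nia.
- move=> [[m k] [j l]]; rewrite mem_sols4 /rank_pairs.
  case/and3P => /and4P[m0 k0 j0 l0] /eqP e /andP[ok mj].
  case: ifPn => ol; case: ltnP => // ?; try lia; congr ((_, _), (_, _)); lia.
- move=> [[m s] [d l]]; rewrite mem_sols4 /mixed_parity.
  case/and3P => /and4P[m0 k0 j0 l0] /eqP e /andP[os ol].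
  case: ltnP => ls.
    by rewrite (negPf ol); congr ((_, _), (_, _)); lia.
  by rewrite os; congr ((_, _), (_, _)); lia.
Qed.

(** Two involutions act in turn: (d, l) -> (l/2, 2 d), fixed when l = 2 d, and then the exchange of
    s with the odd part of m, fixed when m is its 2-part times s. *)
Lemma odd_size_mixed_parity n :
  odd (size (sols mixed_parity n)) = odd (size (sols square_pairs n)).
Proof.
rewrite (odd_sols_involution _ (fun '((m, s), (d, l)) => ((m, s), (l./2, 2 * d)))).
- rewrite (odd_sols_involution _ (fun '((m, s), (d, l)) => ((m`_2 * s, m`_2^'), (d, l)))).
  + congr (odd (size _)); apply: eq_in_filter => -[[m s] [d l]].
    rewrite mem_box => /and4P[/andP[m0 _] /andP[s0 _] /andP[d0 _] /andP[l0 _]].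
    congr (_ && _); rewrite /mixed_parity /square_pairs !xpair_eqE !eqxx /= !andbT.
    case os: (odd s) => //=.
    apply/idP/idP.
    * by move=> /and3P[/andP[ol /andP[e1 e2]] e3 e4]; rewrite eq_sym e2 eq_sym.
    * move=> /andP[/eqP-> /eqP e]; rewrite mul2n odd_double doubleK !eqxx /=.
      by rewrite -e eqxx {1}e partC2M_odd ?eqxx.
  + move=> [[m s] [d l]]; rewrite !mem_sols4 /mixed_parity !xpair_eqE !eqxx /=.
    case/and3P => /and4P[m0 s0 -> ->] /eqP e /andP[/andP[os ->]].
    rewrite odd_partC2 muln_gt0 !part_gt0 s0 => -> /=; rewrite andbT -e.
    by rewrite -{3}(partnC 2 m0) mulnAC.
  + move=> [[m s] [d l]]; rewrite mem_sols4 /mixed_parity.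
    case/and3P => /and4P[m0 _ _ _] _ /andP[/andP[os _] _].
    by rewrite part2M_odd // partC2M_odd // partnC.
- move=> [[m s] [d l]]; rewrite !mem_sols4 /mixed_parity.
  case/and3P => /and4P[-> -> d0 l0] /eqP e /andP[-> ol].
  have [h ?] : exists h, l = h.*2 by exists l./2; lia.
  subst l; rewrite doubleK mul2n odd_double /=; lia.
- move=> [[m s] [d l]]; rewrite mem_sols4 /mixed_parity.
  case/and3P => _ _ /andP[_ ol]; congr ((_, _), (_, _)); lia.
Qed.

(** * From j > 2 m with j, k odd to n = 2^(a+1) o^2 *)

Definition odd_far_pairs : pred quad :=
  fun '((m, k), (j, l)) => [&& odd k, odd j & 2 * m < j].

(** The second pair repeats the first in reverse order, so the form equals 2 o e = 2^(a+1) o^2,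
    where 2^a is the 2-part of e. *)
Definition rect_squares : pred quad :=
  fun '((o, e), (d, l)) => [&& odd o, e == e`_2 * o, ~~ odd e, d == e & l == o].

Lemma odd_size_odd_far_pairs n :
  odd (size (sols odd_far_pairs n)) = odd (size (sols rect_squares n)).
Proof.
pose rect : pred quad :=
  fun '((o, e), (d, l)) => [&& odd o, ~~ odd e, d == e & l == o].
rewrite (odd_sols_involution _
  (fun '((m, k), (j, l)) => ((l, j - 2 * m), (k + 2 * l, m)))); first last.
- move=> [[m k] [j l]]; rewrite mem_sols4 /odd_far_pairs.
  case/and3P => _ _ /and3P[_ _ ?]; congr ((_, _), (_, _)); lia.
- move=> [[m k] [j l]]; rewrite !mem_sols4 /odd_far_pairs.
  case/and3P => /and4P[? ? ? ?] /eqP ? /and3P[? ? ?].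
  have [d ?] : exists d, j = d + 2 * m by exists (j - 2 * m); lia.
  subst j; rewrite addnK; lia.
(* Fixed points have l = m and j = k + 2 m, so n = 2 m (m + k). As k is odd, m and m + k have
   opposite parities; [rect] lists the odd one first. *)
transitivity (odd (size (sols rect n))).
  congr odd; apply: (size_sols_bij _ _
    (fun '((m, k), _) => if odd m then ((m, m + k), (m + k, m))
                         else ((m + k, m), (m, m + k)))
    (* The smaller of o and e is m, their difference is k and their sum is j. *)
    (fun '((o, e), _) => if o < e then ((o, e - o), (o + e, o))
                         else ((e, o - e), (o + e, e)))).
  - move=> [[m k] [j l]]; rewrite mem_sols4 /odd_far_pairs !xpair_eqE.
    case/and3P => /and4P[? ? ? ?] /eqP e /andP[/and3P[ok ? ?] fx].
    have [? ?] : l = m /\ j = k + 2 * m by lia.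
    subst l j.
    case: ifPn => om; rewrite mem_sols4 /rect oddD ?om ?(negPf om) ok !eqxx /= ?andbT.
      by lia.
    by lia.
  - move=> [[o e] [d l]]; rewrite mem_sols4 /rect.
    case/and3P => /and4P[? ? ? ?] /eqP e' /and4P[oo oe /eqP ? /eqP ?]; subst d l.
    have ? : o <> e by move=> oe'; rewrite -oe' oo in oe.
    case: ltnP => oe_lt; rewrite mem_sols4 /odd_far_pairs !xpair_eqE.
      have [h ?] : exists h, e = o + h by exists (e - o); lia.
      by subst e; rewrite addKn; lia.
    have [h ?] : exists h, o = e + h by exists (o - e); lia.
    by subst o; rewrite addKn; lia.
  - move=> [[m k] [j l]]; rewrite mem_sols4 /odd_far_pairs !xpair_eqE.
    case/and3P => /and4P[? ? ? ?] /eqP e /andP[/and3P[ok ? ?] fx].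
    have [? ?] : l = m /\ j = k + 2 * m by lia.
    subst l j.
    by case: ifPn => om; case: ltnP => ?; congr ((_, _), (_, _)); lia.
  - move=> [[o e] [d l]]; rewrite mem_sols4 /rect.
    case/and3P => /and4P[? ? ? ?] /eqP ? /and4P[oo oe /eqP -> /eqP ->].
    by case: ltnP => ?; rewrite ?oo ?(negPf oe); congr ((_, _), (_, _)); lia.
(* The second involution exchanges o with the odd part of e; it fixes the pairs where these
   agree. *)
rewrite (odd_sols_involution _
  (fun '((o, e), _) => ((e`_2^', e`_2 * o), (e`_2 * o, e`_2^')))).
- congr (odd (size _)); apply: eq_in_filter => -[[o e] [d l]].
  rewrite mem_box => /and4P[/andP[o0 _] /andP[e0 _] /andP[d0 _] /andP[l0 _]].
  congr (_ && _); rewrite /rect /rect_squares !xpair_eqE.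
  case oo: (odd o) => //=.
  apply/idP/idP.
  + case/andP => /and3P[-> /eqP-> /eqP->] /andP[/andP[_ e2] _].
    by rewrite eq_sym e2 !eqxx.
  + case/and4P => /eqP e2 -> /eqP-> /eqP->.
    have e3 : e`_2^' = o by rewrite e2 partC2M_odd.
    by rewrite e3 -e2 !eqxx.
- move=> [[o e] [d l]]; rewrite !mem_sols4 /rect.
  case/and3P => /and4P[o0 e0 _ _] /eqP <- /and4P[oo oe /eqP-> /eqP->].
  rewrite !muln_gt0 !part_gt0 o0 odd_partC2 !eqxx /= andbT.
  have e2 : odd e`_2 = false.
    by rewrite -(partnC 2 e0) oddM odd_partC2 andbT in oe; apply/negbTE.
  rewrite oddM e2 /= andbT; apply/eqP.
  by move: (e`_2) (e`_2^') (partnC 2 e0) => u v <-; lia.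
- move=> [[o e] [d l]]; rewrite mem_sols4 /rect.
  case/and3P => /and4P[o0 e0 _ _] _ /and4P[oo oe /eqP-> /eqP->].
  by rewrite part2M_odd // partC2M_odd // partnC.
Qed.

(** * Divisibility of the two forms by 7 *)

Lemma dvd7_form a s d : 7 %| 2 ^ a * s ^ 2 + 2 * d ^ 2 -> (7 %| s) && (7 %| d).
Proof.
have w : 2 ^ a %% 7 \in [:: 1; 2; 4].
  elim: a => // a; rewrite expnS -modnMmr !inE => /or3P[] /eqP -> //.
rewrite /dvdn -modnDm -[(2 ^ a * _) %% 7]modnMm -[(2 * _) %% 7]modnMm
  -[s ^ 2 %% 7]modnXm -[d ^ 2 %% 7]modnXm.
have [] : (s %% 7 \in iota 0 7) /\ (d %% 7 \in iota 0 7).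
  by rewrite !mem_iota !ltn_pmod.
move: (2 ^ a %% 7) (s %% 7) (d %% 7) w => b x y bP xP yP.
(* Only the residues of 2^a, s and d matter, and these 3 * 7 * 7 cases are decided by
   computation. *)
have : all (fun b => all (fun x => all (fun y =>
  ((b * (x ^ 2 %% 7) %% 7 + (2 %% 7) * (y ^ 2 %% 7) %% 7) %% 7 == 0) ==> (x == 0) && (y == 0))
  (iota 0 7)) (iota 0 7)) [:: 1; 2; 4] by [].
by move=> /allP/(_ _ bP)/allP/(_ _ xP)/allP/(_ _ yP)/implyP.
Qed.

Lemma part2M7 m : 0 < m -> (7 * m)`_2 = m`_2.
Proof. by move=> m0; rewrite partnM // part_p'nat ?mul1n. Qed.

(** As 7 is odd, scaling changes neither parities nor 2-parts, so the conditions are invariant. Once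
    7 divides s and d, it also divides m and l, which are multiples of them. *)
Lemma size_square_pairs_mul7 n :
  size (sols square_pairs (7 * n)) = if 7 %| n then size (sols square_pairs (n %/ 7)) else 0.
Proof.
apply: size_sols_mul7.
- move=> [[m s] [d l]] /and4P[/= m0 _ _ _]; rewrite /square_pairs /scale7 /=.
  by rewrite part2M7 // oddM /= !(mulnCA _ 7) !eqn_pmul2l.
- move=> [[m s] [d l]] /and4P[/= m0 _ _ _] /and3P[_ /eqP-> /eqP mE].
  have -> : qform ((m, s), (d, 2 * d)) = 2 ^ logn 2 m * s ^ 2 + 2 * d ^ 2.
    by rewrite /qform /= {1}mE -p_part; lia.
  by case/dvd7_form/andP=> s7 d7; rewrite /= {1}mE s7 d7 !dvdn_mull.
Qed.

(** Here the form is 2^(a+1) o^2, so divisibility by 7 forces 7 | o, and e is a multiple of o. *)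
Lemma size_rect_squares_mul7 n :
  size (sols rect_squares (7 * n)) = if 7 %| n then size (sols rect_squares (n %/ 7)) else 0.
Proof.
apply: size_sols_mul7.
- move=> [[o e] [d l]] /and4P[/= _ e0 _ _]; rewrite /rect_squares /scale7 /=.
  by rewrite part2M7 // !oddM /= !(mulnCA _ 7) !eqn_pmul2l.
- move=> [[o e] [d l]] /and4P[/= _ e0 _ _] /and5P[_ /eqP eE _ /eqP-> /eqP->].
  have -> : qform ((o, e), (e, o)) = 2 ^ (logn 2 e).+1 * o ^ 2.
    by rewrite /qform /= {1 2}eE expnS -p_part; lia.
  rewrite Gauss_dvdr ?coprimeXr // Euclid_dvdX // andbT => o7.
  by rewrite /= o7 {1 2}eE dvdn_mull.
Qed.

(** * Parity of the counts at 7 n *)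

Definition omega_pairs : pred quad :=
  fun '((m, k), (j, l)) => [&& odd k, m < j & (j <= 2 * m) || ~~ odd j].

Lemma odd_rank_pairs_mul7 n : odd (size (sols rank_pairs (7 * n))) =
  (7 %| n) && odd (size (sols rank_pairs (n %/ 7))).
Proof.
rewrite !size_rank_pairs !odd_size_mixed_parity size_square_pairs_mul7.
by case: (7 %| n).
Qed.

(** Among the solutions with m < j, those excluded by the extra condition have j odd and j > 2 m;
    subtracting them is adding them modulo 2. *)
Lemma odd_omega_pairs n : odd (size (sols omega_pairs n)) =
  odd (size (sols rank_pairs n)) (+) odd (size (sols odd_far_pairs n)).
Proof.
pose near : pred quad := fun '((m, k), (j, l)) => (j <= 2 * m) || ~~ odd j.
rewrite (size_sols_split rank_pairs near) oddD.
rewrite (_ : sols (fun x => rank_pairs x && near x) n = sols omega_pairs n).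
  rewrite (_ : sols (fun x => rank_pairs x && ~~ near x) n = sols odd_far_pairs n).
    by rewrite -addbA addbb addbF.
  by apply: eq_filter => -[[m k] [j l]] /=; congr (_ && _); lia.
by apply: eq_filter => -[[m k] [j l]] /=; congr (_ && _); lia.
Qed.

Lemma odd_omega_pairs_mul7 n : odd (size (sols omega_pairs (7 * n))) =
  (7 %| n) && odd (size (sols omega_pairs (n %/ 7))).
Proof.
rewrite !odd_omega_pairs odd_rank_pairs_mul7 !odd_size_odd_far_pairs size_rect_squares_mul7.
by case: (7 %| n).
Qed.

(** * Sums and congruences *)

Lemma size_sols_sum R n : size (sols R n) =
  \sum_(m <- iota 1 n) \sum_(k <- iota 1 n) \sum_(j <- iota 1 n) \sum_(l <- iota 1 n)
    ((m * k + j * l == n) && R ((m, k), (j, l)) : nat).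
Proof.
rewrite size_filter -sum1_count big_mkcond /= !big_allpairs /=.
apply: eq_bigr => m _; apply: eq_bigr => k _; rewrite big_allpairs.
by apply: eq_bigr => j _; apply: eq_bigr => l _; rewrite /qform /=; case: (_ && _).
Qed.

Lemma eqmodD d a b a' b' :
  a = a' %[mod d] -> b = b' %[mod d] -> a + b = a' + b' %[mod d].
Proof. by move=> ea eb; rewrite -modnDm ea eb modnDm. Qed.

Lemma eqmod_sum (I : eqType) (r : seq I) (F G : I -> nat) d :
  {in r, forall i, F i = G i %[mod d]} ->
  \sum_(i <- r) F i = \sum_(i <- r) G i %[mod d].
Proof.
elim: r => [|i r IHr] FG; first by rewrite !big_nil.
rewrite !big_cons; apply: eqmodD; first by apply: FG; rewrite mem_head.
by apply: IHr => j jr; apply: FG; rewrite inE jr orbT.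
Qed.

(** Serves to change index sets, for instance from a range to the divisors of n or to a single
    cofactor. *)
Lemma eq_sum_support (I : eqType) (r s : seq I) (F : I -> nat) :
  uniq r -> uniq s -> (forall i, F i != 0 -> (i \in r) = (i \in s)) ->
  \sum_(i <- r) F i = \sum_(i <- s) F i.
Proof.
move=> ur us rs.
have supp (t : seq I) : \sum_(i <- t) F i = \sum_(i <- [seq i <- t | F i != 0]) F i.
  by rewrite big_filter [RHS]big_mkcond; apply: eq_bigr => i _; case: eqP.
rewrite supp [RHS]supp; apply/perm_big/uniq_perm; rewrite ?filter_uniq // => i.
by rewrite !mem_filter; case: eqVneq => // /rs.
Qed.

Lemma sum_delta n k (G : nat -> nat) :
  \sum_(i < n.+1) (i == k :> nat) * G i = (k <= n) * G k.
Proof.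
case: leqP => kn.
  rewrite (bigD1 (Ordinal (kn : k < n.+1))) //= eqxx big1 ?addn0 // => i.
  by rewrite -val_eqE /= => /negPf->.
rewrite big1 // => i _; case: eqP => // ik.
by move: (ltn_ord i); rewrite ik ltnS leqNgt kn.
Qed.

(** (1 + 2 a)(1 + 2 b) = 1 + 2 (a + b) + 4 a b, and the last term vanishes modulo 4. *)
Lemma fmul_1p2 (f g a b : nat -> nat) n :
  (forall i, i <= n -> f i = (i == 0) + 2 * a i %[mod 4]) ->
  (forall i, i <= n -> g i = (i == 0) + 2 * b i %[mod 4]) ->
  fmul f g n = (n == 0) + 2 * (a n + b n) %[mod 4].
Proof.
move=> fE gE.
(* The right side is written as the convolution 1 * (1 + 2 b) + (2 a) * 1, so that the two sums can
   be compared term by term. *)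
have -> : (n == 0) + 2 * (a n + b n) =
    \sum_(i < n.+1) ((i == 0 :> nat) * ((n - i == 0) + 2 * b (n - i))
                   + (i == n :> nat) * (2 * a i)).
  rewrite big_split /= (sum_delta n n (fun i => 2 * a i))
    (sum_delta n 0 (fun i => (n - i == 0) + 2 * b (n - i))).
  by rewrite leqnn subn0 !mul1n; lia.
apply: eqmod_sum => i _; have lein : i <= n by rewrite -ltnS ltn_ord.
rewrite -modnMm fE // gE ?leq_subr // modnMm subn_eq0.
have -> : (i == n :> nat) = (n <= i) by rewrite eqn_leq lein.
move: (n <= i) (i == 0 :> nat) (a i) (b _) => [] [] x y /=.
- by rewrite (_ : _ * _ = y * x * 4 + (1 * (1 + 2 * y) + 1 * (2 * x))) ?modnMDl //; lia.
- by rewrite (_ : _ * _ = y * x * 4 + (0 * (1 + 2 * y) + 1 * (2 * x))) ?modnMDl //; lia.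
- by rewrite (_ : _ * _ = y * x * 4 + (1 * (0 + 2 * y) + 0 * (2 * x))) ?modnMDl //; lia.
- by rewrite (_ : _ * _ = y * x * 4 + 0) ?modnMDl //; lia.
Qed.

Lemma onepq_geomq j n : 0 < j ->
  fmul (onepq j) (geomq j) n = (n == 0) + 2 * ((0 < n) && (j %| n)).
Proof.
move=> j0; rewrite /fmul /onepq /geomq.
under eq_bigr do rewrite mulnDl.
rewrite big_split /= (sum_delta n 0 (fun i => j %| n - i)) (sum_delta n j (fun i => j %| n - i)).
rewrite subn0 mul1n; case: n => [|n]; first by rewrite dvdn0 leqn0; lia.
case: (leqP j n.+1) => jn; last by rewrite gtnNdvd //=; lia.
have -> : (j %| n.+1 - j) = (j %| n.+1) by rewrite -[in RHS](subnK jn) dvdn_addl.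
by case: (j %| n.+1).
Qed.

(** The reindexing [h] covers both the finite product and the infinite ones, whose factors are
    shifted or restricted to even exponents. *)
Lemma prod_onepq_geomq (h : nat -> nat) (r : seq nat) n :
  {in r, forall k, 0 < h k} ->
  (\big[fmul/fone]_(k <- r) fmul (onepq (h k)) (geomq (h k))) n =
  (n == 0) + 2 * \sum_(k <- r) ((0 < n) && (h k %| n)) %[mod 4].
Proof.
elim: r n => [|k r IHr] n h0; first by rewrite !big_nil addn0.
rewrite !big_cons; apply: (fmul_1p2 _ _ (fun i => (0 < i) && (h k %| i))
  (fun i => \sum_(k <- r) ((0 < i) && (h k %| i)))) => i _.
  by rewrite onepq_geomq // h0 ?mem_head.
by apply: IHr => j jr; rewrite h0 // inE jr orbT.
Qed.

(** The list [r] of factors may depend on v through the truncation of an infinite product; the right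
    side uses one range for all v up to N. Entries of [r] beyond v contribute nothing. *)
Lemma sum_divisor_pairs (P : pred nat) (r : seq nat) v N :
  uniq r -> v <= N -> {in r, forall j, P j && (0 < j)} ->
  (forall j, P j -> 0 < j <= v -> j \in r) ->
  \sum_(j <- r) ((0 < v) && (j %| v)) =
  \sum_(j <- iota 1 N) \sum_(l <- iota 1 N) (P j && (j * l == v)).
Proof.
move=> ur vN rP Pr.
have -> : \sum_(j <- iota 1 N) \sum_(l <- iota 1 N) (P j && (j * l == v)) =
    \sum_(j <- iota 1 N) [&& P j, 0 < v & j %| v].
  apply: eq_big_seq => j; rewrite mem_iota => /andP[j0 _].
  case: (P j) => /=; last by rewrite big1.
  have [v0|v0] := posnP v.
    rewrite big_seq big1 // => l; rewrite mem_iota v0 muln_eq0.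
    by case: (l) j0 => [//|?]; case: (j).
  have [/dvdnP[q vE]|jv] := boolP (j %| v); last first.
    by rewrite big1 // => l _; case: eqP jv => // <-; rewrite dvdn_mulr.
  rewrite (eq_sum_support _ _ [:: q]) ?iota_uniq //.
    by rewrite big_seq1 vE mulnC eqxx.
  move=> l; rewrite eqb0 negbK inE mem_iota => /eqP jl.
  have -> : l = q by apply/eqP; rewrite -(eqn_pmul2l j0) jl vE mulnC.
  by rewrite eqxx; move: v0 vN; rewrite vE; nia.
transitivity (\sum_(j <- r) [&& P j, 0 < v & j %| v]).
  by apply: eq_big_seq => j jr; case/andP: (rP j jr) => ->.
apply: eq_sum_support; rewrite ?iota_uniq // => j.
rewrite eqb0 negbK => /and3P[Pj v0 jv]; rewrite mem_iota add1n ltnS.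
have jv' := dvdn_leq v0 jv; have j0 := dvdn_gt0 v0 jv.
by rewrite Pr // j0 ?jv' // (leq_trans jv' vN).
Qed.

Lemma invsqE m n : 0 < m -> invsq m n = (m %| n) * (n %/ m).+1.
Proof.
move=> m0; rewrite /invsq /fmul /geomq.
have -> : (n %/ m).+1 = \sum_(i < n.+1) (m %| i).
  by rewrite big_ord_recl dvdn0 divn_count_dvd big_add1 big_mkord.
rewrite big_distrr /=; apply: eq_bigr => i _.
have lein : i <= n by rewrite -ltnS ltn_ord.
case mi: (m %| i); last by rewrite muln0.
by rewrite mul1n muln1 dvdn_subl.
Qed.

(** This is q^m/(1-q^m)^2 = sum of k q^(m k). The factor [(m * k <= n)] discards the terms where
    [n - m * k] would be truncated to 0. *)
Lemma qpow_invsq_coef (T : fps) m n : 0 < m <= n ->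
  fmul (qpow m) (fmul (invsq m) T) n =
  \sum_(k <- iota 1 n) (m * k <= n) * k * T (n - m * k).
Proof.
case/andP=> m0 mn; rewrite {1}/fmul /qpow (sum_delta n m (fun i => fmul (invsq m) T (n - i))).
rewrite mn mul1n /fmul.
(* Both sides are sums over the exponent u = m k; on the left u = m + i. *)
pose F u := (m %| u) * ((u <= n) * (u %/ m) * T (n - u)).
transitivity (\sum_(u <- [seq m * k | k <- iota 1 n]) F u); last first.
  by rewrite big_map; apply: eq_bigr => k _; rewrite /F dvdn_mulr // mul1n mulKn.
transitivity (\sum_(u <- iota m (n - m).+1) F u); last first.
  apply: eq_sum_support; rewrite ?iota_uniq ?map_inj_uniq ?iota_uniq //.
    by move=> x y /eqP; rewrite eqn_pmul2l // => /eqP.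
  move=> u; rewrite /F !muln_eq0 !negb_or !eqb0 !negbK -!lt0n.
  case/and3P => /dvdnP[k ->] /andP[ukn uk] _.
  rewrite mulnK // in uk; rewrite mulnC mem_map ?mem_iota; first by nia.
  by move=> x y /eqP; rewrite eqn_pmul2l // => /eqP.
rewrite (_ : iota m _ = map (addn m) (iota 0 (n - m).+1)) ?big_map; last first.
  by rewrite -iotaDl addn0.
rewrite -(big_mkord xpredT (fun i => invsq m i * T (n - m - i))).
rewrite /index_iota subn0; apply: eq_big_seq => i; rewrite mem_iota => /andP[_ ilt].
rewrite invsqE // /F dvdn_addr // divnDl // divnn m0 add1n subnDA.
have -> : m + i <= n by lia.
by rewrite mul1n mulnA.
Qed.

(** [P m j] tells which factors (1+q^j)/(1-q^j) enter the m-th product. In k (1 + 2 X), the constant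
    term contributes k when m k = n, and 2 k X depends only on the parity of k modulo 4. *)
Lemma spt_like_coef (P : nat -> pred nat) (T : nat -> fps) (S : nat -> fps) n :
  (forall m, S m = fmul (qpow m) (fmul (invsq m) (T m))) ->
  (forall m v, 0 < m -> v <= n -> T m v =
     (v == 0) + 2 * \sum_(j <- iota 1 n) \sum_(l <- iota 1 n) (P m j && (j * l == v))
     %[mod 4]) ->
  fsum_from1 S n = \sum_(m <- iota 1 n) \sum_(k <- iota 1 n) (m * k == n) * k
    + 2 * size (sols (fun '((m, k), (j, l)) => odd k && P m j) n) %[mod 4].
Proof.
move=> SE TE; rewrite /fsum_from1 /index_iota subSS subn0 size_sols_sum.
rewrite !big_distrr -big_split /=; apply: eqmod_sum => m; rewrite mem_iota add1n ltnS => mn.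
rewrite SE qpow_invsq_coef // big_distrr -big_split /=; apply: eqmod_sum => k _.
have [mkn|mkn] := leqP (m * k) n; last first.
  rewrite mul0n big1 ?muln0 ?gtn_eqF // => j _; rewrite big1 // => l _.
  by rewrite gtn_eqF // (leq_trans mkn) // leq_addr.
rewrite mul1n -modnMm TE ?leq_subr //; last by case/andP: mn.
rewrite modnMm subn_eq0 eqn_leq mkn /=.
set X := \sum_(j <- _) _; set Y := \sum_(j <- _) _.
have -> : Y = odd k * X.
  rewrite /X /Y big_distrr; apply: eq_bigr => j _; rewrite big_distrr; apply: eq_bigr => l _.
  rewrite -[in LHS](subnKC mkn) eqn_add2l andbC -andbA.
  by case: (odd k); case: (P m j); case: eqP.
rewrite -{1}(odd_double_half k) (_ : _ * _ = k./2 * X * 4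
    + ((n <= m * k) * (odd k + k./2.*2) + 2 * (odd k * X))).
  by rewrite modnMDl odd_double_half.
by lia.
Qed.

(** * Divisor sums *)

Lemma sum_mul_pairs n : 0 < n ->
  \sum_(m <- iota 1 n) \sum_(k <- iota 1 n) (m * k == n) * k = \sum_(d <- divisors n) d.
Proof.
move=> n0; rewrite exchange_big /=.
transitivity (\sum_(k <- iota 1 n) (k %| n) * k).
  apply: eq_bigr => k _; rewrite -big_distrl; congr (_ * _).
  have [/dvdnP[q nE]|kn] := boolP (k %| n); last first.
    by rewrite big1 // => m _; case: eqP kn => // <-; rewrite dvdn_mull.
  have k0 : 0 < k by move: n0; rewrite nE muln_gt0 => /andP[].
  rewrite (eq_sum_support _ _ [:: q]) ?iota_uniq //.
    by rewrite big_seq1 nE eqxx.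
  move=> m; rewrite eqb0 negbK inE mem_iota nE eqn_pmul2r // => /eqP ->.
  by rewrite eqxx; nia.
transitivity (\sum_(k <- divisors n) (k %| n) * k).
  apply: eq_sum_support; rewrite ?iota_uniq ?divisors_uniq // => k.
  rewrite muln_eq0 negb_or eqb0 negbK => /andP[kn _].
  have k1 := dvdn_gt0 n0 kn; have k2 := dvdn_leq n0 kn.
  by rewrite -dvdn_divisors // kn mem_iota; lia.
by apply: eq_big_seq => k; rewrite -dvdn_divisors // => ->; rewrite mul1n.
Qed.

Lemma sum_divisors_dvd7 n : 0 < n ->
  \sum_(d <- divisors n) (7 %| d) * d =
  if 7 %| n then 7 * \sum_(d <- divisors (n %/ 7)) d else 0.
Proof.
move=> n0; case: ifPn => [/dvdnP[q nE]|n7].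
  rewrite nE mulnK // in n0 *; have q0 : 0 < q by lia.
  transitivity (\sum_(d <- [seq 7 * e | e <- divisors q]) (7 %| d) * d).
    apply: eq_sum_support; rewrite ?map_inj_uniq ?divisors_uniq //.
      by move=> x y; lia.
    move=> d; rewrite muln_eq0 negb_or eqb0 negbK => /andP[/dvdnP[e ->] _].
    rewrite -dvdn_divisors // dvdn_pmul2r // [e * 7]mulnC mem_map ?dvdn_divisors //.
    by move=> x y; lia.
  by rewrite big_map big_distrr; apply: eq_bigr => e _; rewrite dvdn_mulr // mul1n.
rewrite big_seq big1 // => d; rewrite -dvdn_divisors // => dn.
by case: (boolP (7 %| d)) n7 => // d7; rewrite (dvdn_trans d7 dn).
Qed.

(** The divisors prime to 7 have the same sum c for n and for 7 n. Thus sigma(7n) = 7 sigma(n) + c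
    and sigma(n) = 7 sigma(n/7) + c, with sigma(n/7) read as 0 if 7 does not divide n; eliminating c
    gives the identity with 8 sigma(n). *)
Lemma sum_divisors_mul7 n : 0 < n ->
  \sum_(d <- divisors (7 * n)) d =
  (if 7 %| n then \sum_(d <- divisors (n %/ 7)) d else 0) %[mod 4].
Proof.
move=> n0; have n7 : 0 < 7 * n by lia.
have split N : \sum_(d <- divisors N) d =
    \sum_(d <- divisors N) (7 %| d) * d + \sum_(d <- divisors N) ~~ (7 %| d) * d.
  by rewrite -big_split; apply: eq_bigr => d _ /=; case: (7 %| d); lia.
have coprime_part : \sum_(d <- divisors (7 * n)) ~~ (7 %| d) * d =
    \sum_(d <- divisors n) ~~ (7 %| d) * d.
  apply: eq_sum_support; rewrite ?divisors_uniq // => d.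
  rewrite muln_eq0 negb_or eqb0 negbK -!dvdn_divisors // => /andP[d7 _].
  by rewrite Gauss_dvdr // coprime_sym prime_coprime.
have := split n; have := split (7 * n).
rewrite coprime_part !sum_divisors_dvd7 // dvdn_mulr // mulKn //.
case: (7 %| n); lia.
Qed.

(** * Both congruences *)

Lemma mod4_transfer (a b c d : nat) : a = b %[mod 4] -> odd c = odd d ->
  a + 2 * c = b + 2 * d %[mod 4].
Proof. lia. Qed.

Lemma spt_like_mul7 (P : nat -> pred nat) (T S : nat -> fps) n :
  (forall m, S m = fmul (qpow m) (fmul (invsq m) (T m))) ->
  (forall N m v, 0 < m -> v <= N -> T m v =
     (v == 0) + 2 * \sum_(j <- iota 1 N) \sum_(l <- iota 1 N) (P m j && (j * l == v))
     %[mod 4]) ->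
  (forall N, odd (size (sols (fun '((m, k), (j, l)) => odd k && P m j) (7 * N))) =
     (7 %| N) && odd (size (sols (fun '((m, k), (j, l)) => odd k && P m j) (N %/ 7)))) ->
  0 < n -> fsum_from1 S (7 * n) = at_div7 (fsum_from1 S) n %[mod 4].
Proof.
move=> SE TE oddS n0; rewrite (spt_like_coef P T) //; last by move=> *; apply: TE.
rewrite sum_mul_pairs ?muln_gt0 // /at_div7.
have sig := sum_divisors_mul7 _ n0; have := oddS n; case: ifPn => /= n7 par.
  have q0 : 0 < n %/ 7 by case/andP: n7.
  have n7' : 7 %| n by case/andP: n7.
  rewrite (spt_like_coef P T) //; last by move=> *; apply: TE.
  by rewrite sum_mul_pairs //; apply: mod4_transfer => //; rewrite n7' in sig par.
(* For n > 0, divisibility by 7 already makes n / 7 positive, so the default value 0 occurs only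
   when 7 does not divide n. *)
have n7' : (7 %| n) = false.
  apply: contraNF n7 => n7'; rewrite n7' divn_gt0 // dvdn_leq //.
rewrite n7' in sig par.
by rewrite -[0](addn0 (2 * 0)); apply: (mod4_transfer _ 0 _ 0).
Qed.

Theorem theorem1p7 (n : nat) (hn : 0 < n) :
  sptbar (7 * n) = at_div7 sptbar n %[mod 4] /\
  sptbar_omega (7 * n) = at_div7 sptbar_omega n %[mod 4].
Proof.
split.
- apply: (spt_like_mul7 (fun m j => m < j)
    (fun m => fprod_inf (fun k => fmul (onepq (m + 1 + k)) (geomq (m + 1 + k)))) spt_term) => //.
  + move=> N m v m0 vN; rewrite /fprod_inf /Defs.fprod prod_onepq_geomq => [|k _]; last by lia.
    congr (_ %% 4); congr (_ + 2 * _).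
    (* The first v factors have exponents m + 1, ..., m + v, which include every j with m < j <=
       v. *)
    rewrite -(sum_divisor_pairs (fun j => m < j) [seq m + 1 + k | k <- index_iota 0 v]) //.
    * by rewrite big_map.
    * by rewrite map_inj_uniq ?iota_uniq // => x y; lia.
    * by move=> _ /mapP[k _ ->]; lia.
    * move=> j mj /andP[j0 jv]; apply/mapP; exists (j - (m + 1)); last by lia.
      by rewrite mem_index_iota; lia.
  + exact: odd_rank_pairs_mul7.
- pose h j := fmul (onepq j) (geomq j).
  apply: (spt_like_mul7 (fun m j => (m < j) && ((j <= 2 * m) || ~~ odd j))
    (fun m => fmul (Defs.fprod (m + 1) (2 * m + 1) h)
                   (fprod_inf (fun k => h (2 * m + 2 + 2 * k)))) sptw_term n) => //.
  + move=> N m v m0 vN.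
    rewrite (fmul_1p2 _ _
      (fun u => \sum_(j <- index_iota (m + 1) (2 * m + 1)) ((0 < u) && (j %| u)))
      (fun u => \sum_(k <- index_iota 0 u) ((0 < u) && (2 * m + 2 + 2 * k %| u)))).
    * congr (_ %% 4); congr (_ + 2 * _).
      (* The finite product supplies m < j <= 2 m, the infinite one the even j >= 2 m + 2. *)
      rewrite -(sum_divisor_pairs _ (index_iota (m + 1) (2 * m + 1) ++
        [seq 2 * m + 2 + 2 * k | k <- index_iota 0 v])) //.
      - by rewrite big_cat big_map.
      - rewrite cat_uniq iota_uniq map_inj_uniq ?iota_uniq ?andbT /=; last by move=> x y; lia.
        by apply/hasPn => _ /mapP[k _ ->]; rewrite mem_index_iota; lia.
      - move=> j; rewrite mem_cat mem_index_iota => /orP[|/mapP[k _ ->]]; first by lia.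
        by lia.
      - move=> j jP jv; rewrite mem_cat mem_index_iota.
        have [jm|jm] := leqP j (2 * m); first by apply/orP; left; lia.
        (* An even j > 2 m is 2 m + 2 + 2 k with k = j/2 - (m + 1), and k < v because j <= v. *)
        apply/orP; right; apply/mapP; exists (j./2 - (m + 1)); last by lia.
        by rewrite mem_index_iota; lia.
    * move=> i _; rewrite /Defs.fprod (prod_onepq_geomq (fun j => j)) // => j.
      by rewrite mem_index_iota; lia.
    * move=> i _; rewrite /fprod_inf /Defs.fprod.
      by rewrite (prod_onepq_geomq (fun k => 2 * m + 2 + 2 * k)) // => k _; lia.
  + exact: odd_omega_pairs_mul7.
Qed.
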